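(* Let $\mathcal X\subseteq\mathbb R^d$ and let $P,\widehat P$ be probability measures on $\mathcal X$ with densities $p,\hat p$ and the same support. For every $\lambda\in[0,+\infty)\cup\{+\infty\}$, $$\alpha_\lambda(P\Vert\widehat P)=\min(1,\lambda)-\mathcal D_{\lambda\text{-PR}}(P\Vert\widehat P),$$ where $\alpha_\lambda(P\Vert\widehat P)=\int_{\mathcal X}\min\left(\lambda p(x),\hat p(x)\right)dx$ is the precision at trade-off parameter $\lambda$ and $\mathcal D_{\lambda\text{-PR}}$ is the PR-divergence with trade-off parameter $\lambda$.
   Context: Densities are with respect to Lebesgue measure. Sharing the same support means that $p>0$ exactly where $\hat p>0$ (up to null sets), and integrals are taken over this common support. For a convex lower semi-continuous $f:[0,\infty)\to\mathbb R$ with $f(1)=0$, the $f$-divergence is $\mathcal D_f(P\Vert\widehat P)=\int_{\mathcal X}\hat p(x)\,f\!\left(\frac{p(x)}{\hat p(x)}\right)dx$. The PR-divergence $\mathcal D_{\lambda\text{-PR}}$ is the $f_\lambda$-divergence $\mathcal D_{f_\lambda}$ with $f_\lambda(u)=\max(\lambda u,1)-\max(\lambda,1)$ for $\lambda\in[0,\infty)$, and $f_\lambda(u)=0$ for $\lambda=+\infty$. For $\lambda=+\infty$ the integrand $\min(\lambda p(x),\hat p(x))$ is read as $\hat p(x)$ wherever $p(x)>0$. The pairs $(\alpha_\lambda,\beta_\lambda)$ with $\beta_\lambda(P\Vert\widehat P)=\int_{\mathcal X}\min(p(x),\hat p(x)/\lambda)\,dx$ parametrise the precision-recall curve of $\widehat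 P$ against $P$. *)

(* Defs.v *)
From HB Require Import structures.
From mathcomp Require Import all_boot all_order all_algebra.
From mathcomp Require Import all_classical all_reals all_analysis.
Set Implicit Arguments.
Unset Strict Implicit.
Unset Printing Implicit Defensive.
Import Order.TTheory GRing.Theory Num.Theory.
Import numFieldNormedType.Exports.
Local Open Scope classical_set_scope.
Local Open Scope ring_scope.
Local Open Scope ereal_scope.

(* R^d with its Borel sigma-algebra, which for tuples is the one generated by
   the coordinate projections. *)
Notation Rn R d := (d.-tuple (measurableTypeR R)).

(* Lebesgue measure on R^n.+1 is the image of the product of the Lebesgue
   measures on R and R^n under (x, t) |-> x :: t, and R^0 has mass 1.
   [lebesgue_Rn_box] below gives the value on boxes. *)
Section lebesgue_Rn.
Context {R : realType}.

Definition cons_Rn n (xt : measurableTypeR R * Rn R n) : Rn R n.+1 :=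
  [tuple of xt.1 :: xt.2].

Lemma measurable_cons_Rn n : measurable_fun setT (@cons_Rn n).
Proof. exact: measurable_cons. Qed.

Section cons_measure.
Context n (m : {sigma_finite_measure set (Rn R n) -> \bar R}).

Definition cons_measure : set (Rn R n.+1) -> \bar R :=
  pushforward (lebesgue_measure \x m) (@cons_Rn n).

Let cons_measure0 : cons_measure set0 = 0.
Proof. by rewrite /cons_measure /pushforward preimage_set0 measure0. Qed.

Let cons_measure_ge0 A : 0 <= cons_measure A.
Proof. by rewrite /cons_measure /pushforward measure_ge0. Qed.

Let cons_measure_sigma_additive : semi_sigma_additive cons_measure.
Proof.
move=> F mF tF mUF; rewrite /cons_measure /pushforward preimage_bigcup.
have mc (A : set (Rn R n.+1)) : measurable A -> measurable (@cons_Rn n @^-1` A).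
  by move=> mA; rewrite -[X in measurable X]setTI; exact: measurable_cons_Rn.
apply: measure_semi_sigma_additive; first by move=> k; exact: mc.
- apply/trivIsetP => /= i j _ _ ij; rewrite -preimage_setI.
  by move/trivIsetP : tF => /(_ _ _ _ _ ij) ->//; rewrite preimage_set0.
- by rewrite -preimage_bigcup; exact: mc.
Qed.

HB.instance Definition _ := isMeasure.Build _ _ _ cons_measure
  cons_measure0 cons_measure_ge0 cons_measure_sigma_additive.

Let cons_measure_sigma_finite : sigma_finite setT cons_measure.
Proof.
have /sigma_finiteP[F [TF ndF Foo]] := sigma_finiteT (@lebesgue_measure R).
have /sigma_finiteP[G [TG ndG Goo]] := sigma_finiteT m.
pose u (t : Rn R n.+1) : measurableTypeR R * Rn R n :=
  (thead t, [tuple of behead t]).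
have m_u : measurable_fun setT u.
  apply/measurable_fun_pairP; split; first exact: measurable_tnth.
  exact: measurable_behead.
have uK xt : u (cons_Rn xt) = xt.
  by case: xt => x t; rewrite /u /cons_Rn theadE; congr pair; exact/val_inj.
exists (fun k => u @^-1` (F k `*` G k)).
  rewrite -preimage_bigcup [X in u @^-1` X](_ : _ = setT) ?preimage_setT//.
  rewrite -subTset => -[x y] _.
  have [i _ Fx] : (\bigcup_i F i) x by rewrite -TF.
  have [j _ Gy] : (\bigcup_i G i) y by rewrite -TG.
  exists (maxn i j) => //; split.
    by move: x Fx; exact/subsetPset/ndF/leq_maxl.
  by move: y Gy; exact/subsetPset/ndG/leq_maxr.
move=> k; have [mF Fkoo] := Foo k; have [mG Gkoo] := Goo k; split.
  by rewrite -[X in measurable X]setTI; apply: m_u => //; exact: measurableX.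
rewrite /cons_measure /pushforward.
have -> : @cons_Rn n @^-1` (u @^-1` (F k `*` G k)) = F k `*` G k.
  by rewrite -comp_preimage (_ : u \o _ = idfun)//; exact/funext/uK.
by rewrite product_measure1E// lte_mul_pinfty// ge0_fin_numE.
Qed.

HB.instance Definition _ := Measure_isSigmaFinite.Build _ _ _ cons_measure
  cons_measure_sigma_finite.

End cons_measure.

Fixpoint lebesgue_Rn n : {sigma_finite_measure set (Rn R n) -> \bar R} :=
  match n with
  | 0%N => \d_([tuple] : Rn R 0)
  | n'.+1 => cons_measure (lebesgue_Rn n')
  end.

Lemma lebesgue_Rn_box n (A : 'I_n -> set (measurableTypeR R)) :
  (forall i, measurable (A i)) ->
  lebesgue_Rn n [set t | forall i, A i (tnth t i)] =
  \prod_(i < n) lebesgue_measure (A i).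
Proof.
elim: n A => [|n IHn] A mA.
  by rewrite big_ord0 /= diracE mem_set//= => -[].
rewrite big_ord_recl /= /cons_measure /pushforward -IHn; last by move=> i; exact: mA.
rewrite -product_measure1E//; last first.
  rewrite (_ : [set t | _] =
      \bigcap_(i in [set: 'I_n]) (@tnth n (measurableTypeR R) ^~ i @^-1` A (lift ord0 i))).
    apply: fin_bigcap_measurable => // i _.
    by rewrite -[X in measurable X]setTI; exact: measurable_tnth.
  by apply/seteqP; split => t /= At i => [_|]; exact: At.
congr (_ _); apply/seteqP; split => -[x t] /=.
  move=> At; split; first exact: (At ord0).
  by move=> i; have := At (lift ord0 i); rewrite tnthS.
move=> [Ax At] i; have [j ->|->] := unliftP ord0 i; last by [].
by rewrite tnthS.
Qed.

End lebesgue_Rn.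

Section divergences.
Context {R : realType} {d : nat}.
Implicit Types (X : set (Rn R d)) (P : probability (Rn R d) R).
Implicit Types (p q : Rn R d -> R) (lambda : \bar R).

(* P lives on X (take A := ~` X) and has density p there. *)
Definition has_density X P p :=
  [/\ measurable_fun X p, forall x, X x -> (0 <= p x)%R &
      forall A, measurable A ->
        P A = \int[lebesgue_Rn d]_(x in A `&` X) (p x)%:E].

Definition same_support X p q :=
  {ae lebesgue_Rn d, forall x, X x -> ((0 < p x)%R <-> (0 < q x)%R)}.

Definition common_support X p q :=
  X `&` [set x | (0 < p x)%R /\ (0 < q x)%R].

(* Values of f outside [0, +oo[ are irrelevant. *)
Definition divergence_generator (f : R -> R) :=
  [/\ convex_function (`[0%R, +oo[%classic : set R) f,
      lower_semicontinuous
        (fun u : subspace (`[0%R, +oo[%classic : set R) => (f u)%:E) &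
      f 1%R = 0%R].

Definition f_divergence (f : R -> R) X p q :=
  \int[lebesgue_Rn d]_(x in common_support X p q) (q x * f (p x / q x))%:E.

(* The value at -oo is irrelevant: the parameter ranges over [0, +oo]. *)
Definition PR_generator lambda (u : R) : R :=
  if lambda is l%:E then (Num.max (l * u) 1 - Num.max l 1)%R else 0%R.

Definition PR_divergence lambda X p q := f_divergence (PR_generator lambda) X p q.

(* For lambda = +oo and p x > 0, lambda * (p x)%:E = +oo, so that the integrand
   is q x. *)
Definition precision lambda X p q :=
  \int[lebesgue_Rn d]_(x in common_support X p q)
    Order.min (lambda * (p x)%:E) (q x)%:E.

End divergences.

Lemma divergence_generator_PR (R : realType) (lambda : \bar R) :
  0 <= lambda -> divergence_generator (PR_generator lambda).
Proof.
case: lambda => [l|_|//]; first rewrite lee_fin => l0; split.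
- have cvx (a b x y : R) : (0 <= a -> 0 <= b -> a + b = 1 ->
      PR_generator l%:E (a * x + b * y) <=
      a * PR_generator l%:E x + b * PR_generator l%:E y)%R.
    move=> a0 b0 ab; rewrite /PR_generator.
    rewrite !mulrBr [leRHS]addrACA -opprD -mulrDl ab mul1r lerD2r.
    rewrite ge_max; apply/andP; split.
      by rewrite mulrDr !(mulrCA l) lerD// ler_wpM2l// le_max lexx.
    rewrite -[leLHS]ab -[X in (X + _)%R]mulr1 -[X in (_ + X)%R]mulr1.
    by rewrite lerD// ler_wpM2l// le_max lexx orbT.
  move=> t x y _ _; rewrite !convRE; apply: cvx => //; last exact: subrKC.
  by rewrite subr_ge0.
- have cf : continuous (PR_generator l%:E).
    move=> u; apply: cvgB; last exact: cvg_cst.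
    apply: continuous_max; last exact: cvg_cst.
    exact: mulrl_continuous.
  apply/lower_semicontinuousP => a.
  have /continuousP/(_ _ (@open_gt R a)) : {within `[0%R, +oo[, continuous (PR_generator l%:E)}.
    exact: continuous_subspaceT.
  by congr open; apply/seteqP; split => u /=; rewrite lte_fin.
- by rewrite /PR_generator mulr1 subrr.
- by move=> t x y _ _; rewrite /PR_generator convRE !mulr0 addr0.
- by move=> x a a0; exists setT => //; exact: filterT.
- by [].
Qed.

(* Main.v *)
(** On the common support S both densities have integral 1, and there
    [min(l p, q) + q * f_l(p / q) = min(l p, q) + max(l p, q) - max(l, 1) q
    = l p + q - max(l, 1) q], whose integral over S is
    [l + 1 - max(l, 1) = min(1, l)]. *)

Require Import Defs.
From mathcomp Require Import all_boot all_order all_algebra.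
From mathcomp Require Import all_classical all_reals all_analysis.
From mathcomp Require Import measurable_realfun ring.
Import Order.TTheory GRing.Theory Num.Theory.
Local Open Scope classical_set_scope.
Local Open Scope ring_scope.
Local Open Scope ereal_scope.

Lemma common_supportC (R : realType) (d : nat) (X : set (Rn R d))
    (p q : Rn R d -> R) : common_support X p q = common_support X q p.
Proof. by rewrite /common_support; congr (_ `&` _); apply/seteqP; split=> x []. Qed.

Lemma measurable_common_support (R : realType) (d : nat) (X : set (Rn R d))
    (p q : Rn R d -> R) :
  measurable X -> measurable_fun X p -> measurable_fun X q ->
  measurable (common_support X p q).
Proof.
move=> mX mp mq.
(* Measurability on [X] controls preimages only after intersection with [X], hence the repeated
   factor [X]. *)
rewrite (_ : common_support X p q =
    (X `&` p @^-1` `]0%R, +oo[) `&` (X `&` q @^-1` `]0%R, +oo[)).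
  by apply: measurableI; [apply: mp|apply: mq] => //; exact: measurable_itv.
apply/seteqP; split=> x; rewrite /common_support /= !in_itv /= !andbT.
  by move=> [Xx [px qx]].
by move=> [[Xx px] [_ qx]].
Qed.

(** [P] gives no mass to the complement of the common support, since [p] vanishes almost everywhere
    on the part of [X] outside it; the total mass 1 therefore sits on the support. The
    almost-everywhere implication is stated in one direction so that the lemma serves either
    density, with the roles of [p] and [q] exchanged. *)
Lemma integral_density_common_support (R : realType) (d : nat)
    (X : set (Rn R d)) (P : probability (Rn R d) R) (p q : Rn R d -> R) :
  measurable X -> has_density X P p -> measurable_fun X q ->
  {ae lebesgue_Rn d, forall x, X x -> (0 < p x)%R -> (0 < q x)%R} ->
  \int[lebesgue_Rn d]_(x in common_support X p q) (p x)%:E = 1.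
Proof.
move=> mX [mp p0 Pp] mq pq; set S := common_support X p q.
have mS : measurable S by exact: measurable_common_support.
have PSc : P (~` S) = 0.
  have mSX : measurable (~` S `&` X) by apply: measurableI => //; exact: measurableC.
  rewrite Pp; last exact: measurableC.
  rewrite (@ge0_ae_eq_integral _ _ _ _ _ _ (cst 0)) ?integral0//.
  - by apply/measurable_EFinP; exact: (measurable_funS mX).
  - by move=> x [_ Xx]; rewrite lee_fin p0.
  - apply: filterS pq => x pqx [Sx Xx] /=; congr EFin.
    (* If [p x] were positive, [q x] would be too and [x] would lie in [S]; nonnegativity leaves
       [p x = 0]. *)
    apply/eqP; case: (ltgtP (p x) 0%R) (p0 _ Xx) => // px _.
    by case: Sx; split=> //; split=> //; exact: pqx.
have PS : P S = 1.
  by rewrite -(setCK S) probability_setC ?PSc ?sube0//; exact: measurableC.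
by rewrite -PS Pp//; congr (integral _ _ _); rewrite setIidl// => x [].
Qed.

Theorem theorem4p3 (R : realType) (d : nat) (X : set (Rn R d))
    (P Phat : probability (Rn R d) R) (p phat : Rn R d -> R)
    (lambda : \bar R) :
  measurable X ->
  has_density X P p ->
  has_density X Phat phat ->
  same_support X p phat ->
  0 <= lambda ->
  precision lambda X p phat =
    Order.min 1 lambda - PR_divergence lambda X p phat.
Proof.
move=> mX dP dQ pq l0.
have [mp _ _] := dP; have [mq _ _] := dQ.
have Ip : \int[lebesgue_Rn d]_(x in common_support X p phat) (p x)%:E = 1.
  apply: (@integral_density_common_support _ _ _ P) => //.
  by apply: filterS pq => x h /h[].
have Iq : \int[lebesgue_Rn d]_(x in common_support X p phat) (phat x)%:E = 1.
  rewrite common_supportC.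
  apply: (@integral_density_common_support _ _ _ Phat) => //.
  by apply: filterS pq => x h /h[].
rewrite /precision /PR_divergence /f_divergence.
have mS : measurable (common_support X p phat) by exact: measurable_common_support.
have pS x : common_support X p phat x -> (0 < p x)%R by case=> _ [].
have qS x : common_support X p phat x -> (0 < phat x)%R by case=> _ [].
have SX : common_support X p phat `<=` X by move=> x [].
set S := common_support X p phat in Ip Iq mS pS qS SX *.
case: lambda l0 => [l|_|//]; last first.
  (* For [lambda = +oo] the precision is the integral of [phat], the generator is zero, and both
     sides equal 1. *)
  rewrite (eq_integral (fun x => (phat x)%:E)); last first.
    by move=> x /set_mem/pS px; rewrite gt0_mulye ?lte_fin// minye.
  rewrite [X in _ - X]integral0_eq ?sube0 ?Iq ?miney// => x _.
  by rewrite /PR_generator mulr0.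
rewrite lee_fin => l0.
have mpS := measurable_funS mX SX mp; have mqS := measurable_funS mX SX mq.
(* A positive function is its own absolute value, so its integral being 1 already bounds the
   norm. *)
have integrable_gt0 (f : Rn R d -> R) : measurable_fun S f ->
    (forall x, S x -> (0 < f x)%R) ->
    \int[lebesgue_Rn d]_(x in S) (f x)%:E = 1 ->
    (lebesgue_Rn d).-integrable S (EFin \o f).
  move=> mf f0 If; apply/integrableP; split; first exact/measurable_EFinP.
  rewrite (eq_integral (fun x => (f x)%:E)) ?If ?ltry// => x /set_mem/f0 fx.
  by rewrite /= gtr0_norm.
have ip := integrable_gt0 _ mpS pS Ip.
have iq := integrable_gt0 _ mqS qS Iq.
pose m x := Num.min (l * p x)%R (phat x).
have im : (lebesgue_Rn d).-integrable S (EFin \o m).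
  (* On [S], [0 <= m <= phat], so [phat] dominates. *)
  apply: (le_integrable mS _ _ iq).
    apply/measurable_EFinP; apply: measurable_minr => //.
    exact: measurable_funM.
  move=> x Sx /=; rewrite lee_fin (gtr0_norm (qS _ Sx)) ger0_norm.
    by rewrite ge_min lexx orbT.
  by rewrite le_min (ltW (qS _ Sx)) mulr_ge0 ?(ltW (pS _ Sx)).
rewrite (eq_integral (EFin \o m)); last by move=> x _; rewrite -EFinM -EFin_min.
(* As [phat x > 0] on [S], the factor [phat x] enters the maximum and cancels the quotient, giving
   [max (l * p x) (phat x)]; then [max a b = a + b - min a b] makes [m] appear. *)
rewrite [X in _ - X](eq_integral (fun x =>
    (l%:E * (p x)%:E + (1 - Num.max l 1)%:E * (phat x)%:E) - (m x)%:E)); last first.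
  move=> x /set_mem Sx; rewrite /PR_generator -!EFinM -!EFinD; congr EFin.
  have q0 := qS _ Sx; rewrite mulrBr maxr_pMr ?(ltW q0)// mulr1.
  rewrite [(phat x * (l * _))%R]mulrC -mulrA divfK ?gt_eqF// maxr_to_min -/(m x).
  by ring.
have ilp := integrableZl mS l ip.
have ilq := integrableZl mS (1 - Num.max l 1)%R iq.
rewrite integralB//; last exact: integrableD.
rewrite integralD// !integralZl// Ip Iq !mule1.
(* The integral of [m] occurs on both sides; its finiteness moves the equation from the extended
   reals to [R]. *)
have /fineK <- := integrable_fin_num mS im.
rewrite -EFin_min -!(EFinD, EFinN); congr EFin.
(* With [min 1 l = 1 + l - max 1 l], the maximum is the only non-polynomial atom left. *)
by rewrite minr_to_max maxC opprB [in RHS]addrA; ring.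
Qed.
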